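(* Let $A$ be a Banach algebra with a right identity. If $d$ is a Jordan triple left derivation of $A$, then $d$ is a Jordan left derivation.
   Context: Banach algebras are over $\mathbb{C}$ and associative, and are not assumed to be commutative or unital. A right identity of $A$ is an element $e \in A$ with $ae = a$ for all $a \in A$. A linear map $d: A \to A$ (not assumed continuous) is a Jordan left derivation if $d(a^2) = 2a\,d(a)$ for all $a \in A$, and a Jordan triple left derivation if $d(a^3) = 3a^2 d(a)$ for all $a \in A$. *)

(* Defs.v *)
From HB Require Import structures.
From mathcomp Require Import all_boot all_order all_algebra.
From mathcomp Require Import all_classical all_reals all_analysis.

Set Implicit Arguments.
Unset Strict Implicit.
Unset Printing Implicit Defensive.

Local Open Scope ring_scope.

(* MathComp's rings (even pzRingType) are unital, so the possibly non-unital
   product of a Banach algebra is the product [( _ * _ )%g] of a semigroup,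
   whose associativity law is mulgA.  The axioms below make it bilinear over K
   and the norm submultiplicative; [*] in bnormM is the product of K, in which
   the norm takes its values. *)
HB.mixin Record Semigroup_isBanachAlgebra (K : numFieldType) A
    of CompleteNormedModule K A & Semigroup A := {
  bmulDl : forall a b c : A, ((a + b)%R * c)%g = (a * c)%g + (b * c)%g;
  bmulDr : forall a b c : A, (a * (b + c)%R)%g = (a * b)%g + (a * c)%g;
  bscaleAl : forall (k : K) (a b : A), k *: (a * b)%g = ((k *: a)%R * b)%g;
  bscaleAr : forall (k : K) (a b : A), k *: (a * b)%g = (a * (k *: b)%R)%g;
  bnormM : forall a b : A, `|(a * b)%g| <= `|a| * `|b|
}.

#[short(type="banachAlgType")]
HB.structure Definition BanachAlgebra (K : numFieldType) :=
  {A of CompleteNormedModule K A & Semigroup A & Semigroup_isBanachAlgebra K A}.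

Definition jordan_left_derivation (K : numFieldType) (A : banachAlgType K)
    (d : {linear A -> A}) : Prop :=
  forall a : A, d (a * a)%g = (a * d a)%g *+ 2.

Definition jordan_triple_left_derivation (K : numFieldType)
    (A : banachAlgType K) (d : {linear A -> A}) : Prop :=
  forall a : A, d (a * a * a)%g = (a * a * d a)%g *+ 3.

(* Main.v *)
Require Import Defs.
From mathcomp Require Import all_boot all_order all_algebra.
From mathcomp Require Import all_classical all_reals all_analysis.
From mathcomp Require Import complex.

(* Polarizing [d (a^3) = 3 a^2 (d a)] at [(e, b)] and [(a, e)], where [e] is the
   right identity, is enough.  First [d e = 3 e (d e)] forces [d e = 0].  The
   polarization at [(e, b)] then reads [2 d (e b) + d b = 3 e (d b)], which,
   applied to [e b] and multiplied by [e] on the left, yields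
   [d (e b) = e (d b) = d b].  The polarization at [(a, e)] becomes
   [d (a^2) = (a + e a) (d a)], and multiplying it by [e] on the left shows
   [a (d a) = e a (d a)]. *)

Set Implicit Arguments.
Unset Strict Implicit.
Unset Printing Implicit Defensive.

Import GRing.Theory Num.Theory.
Local Open Scope ring_scope.

(** A [numFieldType] has characteristic 0. Below, the argument 1 cancels a factor 2, and 2 a factor
    3. *)
Lemma mulrSn_inj (K : numFieldType) (V : lmodType K) (n : nat) (x y : V) :
  x *+ n.+1 = y *+ n.+1 -> x = y.
Proof.
move=> /eqP; rewrite -subr_eq0 -mulrnBl -scaler_nat scaler_eq0 pnatr_eq0 /=.
by rewrite subr_eq0 => /eqP.
Qed.

(** Expanding the diagonal at [a + b] leaves [P a b + P b a = 0]. Replacing [b] by [- b] flips the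
    sign of [P a b] only, so the two parts are also equal and both vanish. *)
Lemma triadditive_polarize (K : numFieldType) (U : zmodType) (V : lmodType K)
    (m : U -> U -> U -> V) :
  (forall b c, {morph m^~ b ^~ c : x y / x + y}) ->
  (forall a c, {morph (m a)^~ c : x y / x + y}) ->
  (forall a b, {morph m a b : x y / x + y}) ->
  (forall a, m a a a = 0) ->
  forall a b, m a a b + m a b a + m b a a = 0.
Proof.
move=> mDl mDm mDr m0 a b.
have morphN (f : U -> V) : {morph f : x y / x + y} -> {morph f : x / - x}.
  move=> fD x; have f0 : f 0 = 0 by apply: (addrI (f 0)); rewrite -fD !addr0.
  by apply: (addrI (f x)); rewrite -fD !subrr.
have mNl x y z : m (- x) y z = - m x y z by apply: (morphN (m^~ y ^~ z)).
have mNm x y z : m x (- y) z = - m x y z by apply: (morphN ((m x)^~ z)).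
have mNr x y z : m x y (- z) = - m x y z by apply: morphN.
pose P x y := m x x y + m x y x + m y x x.
have Psym x y : P x y + P y x = 0.
  have := m0 (x + y); rewrite mDl !mDm !mDr !m0 add0r addr0 => <-.
  by rewrite /P [RHS](AC ((1*2)*(2*1)) ((1*2*4)*(6*5*3))).
have : - P a b + P b a = 0.
  by rewrite -(Psym a (- b)) /P !(mNl, mNm, mNr) !opprK !opprD.
move=> /eqP; rewrite addrC subr_eq0 => /eqP Pba.
by apply: (@mulrSn_inj _ _ 1); rewrite mul0rn mulr2n -[X in _ + X]Pba Psym.
Qed.

(* The axioms of the mixin mention raw packed structures, which keyed matching
   does not identify with the canonical instances of a [banachAlgType]; the
   lemmas of this section restate them over the latter. *)
Section BanachAlgebraArithmetic.

Variables (K : numFieldType) (A : banachAlgType K).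
Implicit Types a b c : A.

Lemma mulgDl a b c : ((a + b)%R * c)%g = (a * c)%g + (b * c)%g.
Proof. exact: bmulDl. Qed.

Lemma mulgDr a b c : (a * (b + c)%R)%g = (a * b)%g + (a * c)%g.
Proof. exact: bmulDr. Qed.

Lemma mulgZr (k : K) a b : (a * (k *: b)%R)%g = k *: (a * b)%g.
Proof. by rewrite bscaleAr. Qed.

Lemma mulg0r a : (a * 0%R)%g = 0 :> A.
Proof. by rewrite -(scale0r 0) mulgZr !scale0r. Qed.

Lemma mulgMnr a b (n : nat) : (a * (b *+ n)%R)%g = (a * b)%g *+ n :> A.
Proof. by rewrite -!scaler_nat mulgZr. Qed.

End BanachAlgebraArithmetic.

Section RightIdentity.

Variables (K : numFieldType) (A : banachAlgType K) (d : {linear A -> A}).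
Hypothesis jtd : jordan_triple_left_derivation d.

Lemma jordan_triple_left_derivation_polarize (a b : A) :
  d (a * a * b)%g + d (a * b * a)%g + d (b * a * a)%g =
  ((a * a * d b)%g + (a * b * d a)%g + (b * a * d a)%g) *+ 3.
Proof.
(* The defect of the triple identity, made triadditive; [jtd] says that it vanishes on the
   diagonal. *)
pose m (x y z : A) := d (x * y * z)%g - (x * y * d z)%g *+ 3.
have dD (x y : A) : d (x + y)%R = d x + d y by apply: linearD.
have mDl y z : {morph m^~ y ^~ z : x x' / x + x'}.
  by move=> x x'; rewrite /m !mulgDl mulrnDl dD opprD addrACA.
have mDm x z : {morph (m x)^~ z : y y' / y + y'}.
  by move=> y y'; rewrite /m !(mulgDl, mulgDr) mulrnDl dD opprD addrACA.
have mDr x y : {morph m x y : z z' / z + z'}.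
  by move=> z z'; rewrite /m !(dD, mulgDr) mulrnDl opprD addrACA.
have m0 x : m x x x = 0 by rewrite /m jtd subrr.
apply/eqP; rewrite -subr_eq0 !mulrnDl 2!opprD; apply/eqP.
have <- := triadditive_polarize mDl mDm mDr m0 a b.
by rewrite addrACA [X in X + _ = _]addrACA.
Qed.

Variable e : A.
Hypothesis he : forall a : A, (a * e)%g = a.

Lemma jordan_triple_right_id : d e = 0.
Proof.
have de : d e = (e * d e)%g *+ 3 by have := jtd e; rewrite !he.
(* Multiplying [de] by [e] on the left gives [e (d e) = 3 e (d e)], since [e e = e]. *)
have ede : (e * d e)%g = 0 :> A.
  apply: (@mulrSn_inj _ _ 1); rewrite mul0rn; apply: (addrI (e * d e)%g).
  by rewrite -mulrS addr0 {2}de mulgMnr mulgA he.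
by rewrite de ede mul0rn.
Qed.

Let d_eM (b : A) : d (e * b)%g *+ 2 + d b = (e * d b)%g *+ 3.
Proof.
have := jordan_triple_left_derivation_polarize e b.
by rewrite jordan_triple_right_id !mulg0r !addr0 !he -mulr2n.
Qed.

Lemma jordan_triple_mulel (b : A) : (e * d b)%g = d b.
Proof.
(* At [e b], both terms on the left of [d_eM] agree because [e (e b) = e b]. *)
have deeb : (e * d (e * b))%g = d (e * b)%g.
  apply: (@mulrSn_inj _ _ 2); rewrite -d_eM.
  by rewrite mulgA he -mulrSr.
have deb : d (e * b)%g = (e * d b)%g.
  apply: (@mulrSn_inj _ _ 1); apply: (addIr (e * d b)%g).
  rewrite -mulrSr -deeb -mulgMnr -mulgDr d_eM mulgMnr.
  by rewrite mulgA he.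
by have := d_eM b; rewrite deb [RHS]mulrSr => /addrI.
Qed.

Lemma jordan_triple_right_id_mull (b : A) : d (e * b)%g = d b.
Proof.
apply: (@mulrSn_inj _ _ 1); apply: (addIr (d b)).
by rewrite d_eM jordan_triple_mulel -mulrSr.
Qed.

Lemma jordan_triple_right_id_jordan : jordan_left_derivation d.
Proof.
move=> a.
have da2 : d (a * a)%g = (a * d a)%g + (e * a * d a)%g.
  apply: (@mulrSn_inj _ _ 2).
  have := jordan_triple_left_derivation_polarize a e.
  rewrite jordan_triple_right_id mulg0r add0r !he -mulgA.
  by rewrite jordan_triple_right_id_mull -mulr2n -mulrSr.
(* As [e] fixes the values of [d], multiplying [da2] by [e] gives [d (a^2) = 2 e a (d a)]; compare
   with [da2] itself. *)
have eda : (e * a * d a)%g = (a * d a)%g.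
  apply: (addIr (e * a * d a)%g); rewrite -da2 -[RHS]jordan_triple_mulel da2.
  by rewrite mulgDr !mulgA he.
by rewrite da2 eda mulr2n.
Qed.

End RightIdentity.

Theorem theorem3p3 (R : realType) (A : banachAlgType R[i])
    (e : A) (he : forall a : A, (a * e)%g = a)
    (d : {linear A -> A}) :
  jordan_triple_left_derivation d -> jordan_left_derivation d.
Proof. by move=> jtd; apply: (jordan_triple_right_id_jordan jtd he). Qed.
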